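(* Let $\rho\in\mathbb R$, let $\mathbf a=(a_{m,n})_{m,n=1}^\infty$ be a matrix with complex entries and let $\kappa_{\mathbf a}$ be a Dirichlet series kernel on $\mathbb H_\rho$ with coefficient matrix $\mathbf a$. Then the following are equivalent: (i) $\kappa_{\mathbf a}$ is positive semi-definite on $\mathbb H_\rho$; (ii) $\mathbf a$ is formally positive semi-definite. Moreover, if (i) holds, then for every positive integer $n$ the analytic symbol $A_{n,\mathbf a}$ belongs to $\mathscr H_{\mathbf a}$ and $a_{m,n}=\langle A_{n,\mathbf a},A_{m,\mathbf a}\rangle_{\mathscr H_{\mathbf a}}$ for all $m,n\ge1$.
   Context: $\mathbb H_\rho=\{s\in\mathbb C:\Re(s)>\rho\}$. A double Dirichlet series $\sum_{m,n\ge1}c_{m,n}m^{-s}n^{-u}$ is regularly convergent at $(s_0,u_0)$ if the double series converges there and, for all integers $m,n\ge1$, $\sum_{m}c_{m,n}m^{-s_0}$ and $\sum_{n}c_{m,n}n^{-u_0}$ converge. For a complex matrix $\mathbf a$, $\kappa_{\mathbf a}(s,u)=\sum_{m,n\ge1}a_{m,n}m^{-s}n^{-\bar u}$ is a Dirichlet series kernel on $\mathbb H_\rho$ if $(s,u)\mapsto\kappa_{\mathbf a}(s,\bar u)$ is regularly convergent at every point of $\mathbb H_\rho\times\mathbb H_\rho$. A kernel $\kappa$ on a set $X$ is positive semi-definite if every matrix $(\kappa(x_i,x_j))_{i,j=1}^N$ ($x_i\in X$) is positive semi-definite. The matrix $\mathbf a$ is formally positive semi-definite if the kernel $(m,n)\mapsto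 a_{m,n}$ on $\mathbb N$ is positive semi-definite (i.e. all finite sections $(a_{m,n})_{m,n\in F}$ are positive semi-definite). If $\kappa_{\mathbf a}$ is positive semi-definite, $\mathscr H_{\mathbf a}$ is the reproducing kernel Hilbert space of functions on $\mathbb H_\rho$ with kernel $\kappa_{\mathbf a}$ (i.e. $\kappa_{\mathbf a}(\cdot,t)\in\mathscr H_{\mathbf a}$ and $\langle f,\kappa_{\mathbf a}(\cdot,t)\rangle=f(t)$). The analytic symbols of $\mathbf a$ are the Dirichlet series $A_{n,\mathbf a}(s)=\sum_{m\ge1}a_{m,n}m^{-s}$, $s\in\mathbb H_\rho$, $n\ge1$. *)

(* Defs.v *)
(* MathComp + MathComp-Analysis (reals, expR, ln, cos, sin) +
   real-closed's complex numbers R[i] over a realType R. *)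
From HB Require Import structures.
From mathcomp Require Import all_boot all_order all_algebra.
From mathcomp Require Import all_classical all_reals.
From mathcomp Require Import sequences.
From mathcomp.analysis Require Import exp trigo.
From mathcomp Require Import complex.
Set Implicit Arguments. Unset Strict Implicit. Unset Printing Implicit Defensive.
Import Order.TTheory GRing.Theory Num.Theory.
Local Open Scope ring_scope.
Local Open Scope complex_scope.

Section DirichletKernels.
Variable R : realType.
Local Notation C := R[i].

(* n^{-s} = exp(-s log n) = n^{-Re s} (cos(Im s log n) - i sin(Im s log n)),
   for a positive integer n and s : C *)
Definition npow_neg (n : nat) (s : C) : C :=
  (expR (- complex.Re s * ln n%:R) * cos (complex.Im s * ln n%:R))
    +i* (- (expR (- complex.Re s * ln n%:R) * sin (complex.Im s * ln n%:R))).

(* the half plane H_rho as a set of complex numbers and as a type *)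
Definition Hplane (rho : R) : set C := [set s | rho < complex.Re s].
Definition Hrho (rho : R) := {s : C | rho < complex.Re s}.

(* convergence of a complex sequence *)
Definition cvgC (u : nat -> C) (L : C) : Prop :=
  forall e : R, 0 < e -> exists K : nat, forall n, (K <= n)%N -> `|u n - L| < e%:C.

(* partial sums of a single series sum_{m >= 1} f m *)
Definition psum1 (f : nat -> C) (M : nat) : C := \sum_(1 <= m < M.+1) f m.
Definition ser_converges (f : nat -> C) : Prop := exists L, cvgC (psum1 f) L.
Definition ser_sum (f : nat -> C) : C := xget 0 (cvgC (psum1 f)).

(* rectangular partial sums of a double series sum_{m,n >= 1} c m n and
   (Pringsheim) convergence of the double series *)
Definition psum2 (c : nat -> nat -> C) (M N : nat) : C :=
  \sum_(1 <= m < M.+1) \sum_(1 <= n < N.+1) c m n.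
Definition dcvgC (c : nat -> nat -> C) (L : C) : Prop :=
  forall e : R, 0 < e -> exists K : nat, forall M N, (K <= M)%N -> (K <= N)%N ->
    `|psum2 c M N - L| < e%:C.
Definition dser_sum (c : nat -> nat -> C) : C := xget 0 (dcvgC c).

(* sum_{m,n} c_{m,n} m^{-s0} n^{-u0} is regularly convergent at (s0,u0) *)
Definition regularly_convergent (c : nat -> nat -> C) (s0 u0 : C) : Prop :=
  (exists L, dcvgC (fun m n => c m n * npow_neg m s0 * npow_neg n u0) L) /\
  (forall n, (0 < n)%N -> ser_converges (fun m => c m n * npow_neg m s0)) /\
  (forall m, (0 < m)%N -> ser_converges (fun n => c m n * npow_neg n u0)).

(* kappa_a(s,u) = sum_{m,n} a_{m,n} m^{-s} n^{-conj u} *)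
Definition kappa (a : nat -> nat -> C) (s u : C) : C :=
  dser_sum (fun m n => a m n * npow_neg m s * npow_neg n (u^*)).

(* kappa_a is a Dirichlet series kernel on H_rho: (s,u) |-> kappa_a(s, conj u)
   is regularly convergent at every point of H_rho x H_rho *)
Definition dirichlet_series_kernel (rho : R) (a : nat -> nat -> C) : Prop :=
  forall s u, Hplane rho s -> Hplane rho u -> regularly_convergent a s u.

(* positive semi-definite matrices and kernels *)
Definition psd_mx (N : nat) (M : 'M[C]_N) : Prop :=
  forall c : 'I_N -> C, 0 <= \sum_(i < N) \sum_(j < N) (c i)^* * M i j * c j.
Definition psd_kernel (X : Type) (k : X -> X -> C) : Prop :=
  forall (N : nat) (x : 'I_N -> X), psd_mx (\matrix_(i < N, j < N) k (x i) (x j)).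

(* positive integers *)
Definition pnat := {m : nat | (0 < m)%N}.

(* a is formally psd: the kernel (m,n) |-> a_{m,n} on N = {1,2,...} is psd *)
Definition formally_psd (a : nat -> nat -> C) : Prop :=
  psd_kernel (fun m n : pnat => a (sval m) (sval n)).

(* analytic symbols A_{n,a}(s) = sum_{m >= 1} a_{m,n} m^{-s} *)
Definition analytic_symbol (a : nat -> nat -> C) (n : nat) (s : C) : C :=
  ser_sum (fun m => a m n * npow_neg m s).

(* (H, ip) is a reproducing kernel Hilbert space of functions on X with
   kernel k: H is a complex vector space of functions X -> C, ip is an inner
   product on H (linear in the first argument) making H complete, and
   k(., t) \in H with <f, k(., t)> = f t for all f \in H, t \in X. *)
Record is_rkhs (X : Type) (k : X -> X -> C) (H : set (X -> C))
    (ip : (X -> C) -> (X -> C) -> C) : Prop := {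
  rkhs_zero : H (fun _ => 0);
  rkhs_add : forall f g, H f -> H g -> H (fun x => f x + g x);
  rkhs_scale : forall (c : C) f, H f -> H (fun x => c * f x);
  rkhs_ip_linear : forall (c : C) f g h, H f -> H g -> H h ->
    ip (fun x => c * f x + g x) h = c * ip f h + ip g h;
  rkhs_ip_herm : forall f g, H f -> H g -> ip g f = (ip f g)^*;
  rkhs_ip_pos : forall f, H f -> 0 <= ip f f;
  rkhs_ip_def : forall f, H f -> ip f f = 0 -> f = (fun _ => 0);
  rkhs_complete : forall u : nat -> X -> C, (forall n, H (u n)) ->
    (forall e : R, 0 < e -> exists K : nat, forall n m, (K <= n)%N -> (K <= m)%N ->
       `|ip (fun x => u n x - u m x) (fun x => u n x - u m x)| < e%:C) ->
    exists2 f, H f & cvgC (fun n => ip (fun x => u n x - f x) (fun x => u n x - f x)) 0;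
  rkhs_kernel_mem : forall t, H (fun s => k s t);
  rkhs_reproducing : forall f t, H f -> ip f (fun s => k s t) = f t
}.

End DirichletKernels.

(* Main.v *)
(* Passing to the limit in the Hermitian forms of the partial sums of kappa
   shows that a formally psd matrix yields a psd kernel.  Conversely, put
   sigma = rho + 1 and w k = k^-sigma.  Rectangular partial sums of a regularly
   convergent double series are bounded, hence so are the normalized
   coefficients a_{m,n} w_m w_n.  At the real points s_l = sigma + 2 + l one has
   k^{-s_l} = w_k k^-2 (1/k)^l, so a linear combination over l of the evaluations
   at s_l with the coefficients of a polynomial P replaces k^{-s} by
   w_k k^-2 P(1/k).  For each m there are real polynomials P with
   k |-> k^-2 P(1/k) as close as desired, in l^1, to the indicator of {m}.
   Hence a_{m,n} w_m w_n is a limit of values of the form defined by kappa on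
   finite combinations of point evaluations, and inherits positivity; the same
   combinations of kernel functions form a Cauchy sequence in the RKHS whose
   pointwise limit is w_n A_n.  No analyticity is used: for fixed s in H_rho the
   numbers w_n sum_{m <= M} a_{m,n} m^{-s} are bounded in M and n, so the
   approximation applies at every s. *)
Require Import Defs.
From HB Require Import structures.
From mathcomp Require Import all_boot all_order all_algebra.
From mathcomp Require Import all_classical all_reals.
From mathcomp Require Import pseudometric_normed_Zmodule normed_module sequences.
From mathcomp.analysis Require Import exp trigo.
From mathcomp Require Import complex.
From mathcomp Require Import ring lra.
Set Implicit Arguments. Unset Strict Implicit. Unset Printing Implicit Defensive.
Import Normc.
Import numFieldNormedType.Exports Order.TTheory GRing.Theory Num.Theory.
Local Open Scope ring_scope.
Local Open Scope complex_scope.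

(** * Limits of complex sequences *)

Section Limits.
Variable R : realType.
Local Notation C := R[i].

Lemma normc_realE (z : C) : `|z| = (normc z)%:C.
Proof. by []. Qed.

Lemma normr_realC (x : R) : `|x%:C| = `|x|%:C.
Proof. by rewrite normc_def /= expr0n addr0 sqrtr_sqr. Qed.

Lemma cvgCP (u : nat -> C) (L : C) :
  (forall e : R, 0 < e ->
     exists K, forall n, (K <= n)%N -> `|u n - L| <= e%:C) -> cvgC u L.
Proof.
move=> h e e0; have /h[K hK] : 0 < e / 2 by rewrite divr_gt0.
exists K => n /hK /le_lt_trans; apply; rewrite ltcR; lra.
Qed.

Lemma cvgC_close (u v : nat -> C) (a b : C) (e : R) :
  cvgC u a -> cvgC v b ->
  (exists K, forall n, (K <= n)%N -> `|u n - v n| <= e%:C) ->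
  `|a - b| <= e%:C.
Proof.
move=> ua vb [K0 uv]; rewrite normc_realE lecR.
apply/ler_addgt0Pr => d d0; rewrite -lecR -normc_realE.
have d2 : 0 < d / 2 by rewrite divr_gt0.
have [K1 h1] := ua _ d2; have [K2 h2] := vb _ d2.
pose n := maxn K0 (maxn K1 K2).
have {}uv := uv n (leq_maxl _ _).
have {}h1 : `|u n - a| < (d / 2)%:C.
  by apply: h1; rewrite /n maxnCA leq_maxl.
have {}h2 : `|v n - b| < (d / 2)%:C.
  by apply: h2; rewrite /n maxnA leq_maxr.
have -> : a - b = (u n - v n) + ((v n - b) - (u n - a)) by ring.
apply: le_trans (ler_normD _ _) _; rewrite rmorphD /= lerD //.
apply: le_trans (ler_normB _ _) _.
have -> : d%:C = (d / 2)%:C + (d / 2)%:C by rewrite -rmorphD -splitr.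
by rewrite lerD // ltW.
Qed.

Lemma cvgC_unique (u : nat -> C) (a b : C) : cvgC u a -> cvgC u b -> a = b.
Proof.
move=> ua ub; apply/eqP; rewrite -subr_eq0 -normr_le0.
apply: (cvgC_close ua ub); exists 0%N => n _.
by rewrite subrr normr0.
Qed.

Lemma cvgC_cst (a : C) : cvgC (fun _ => a) a.
Proof. by move=> e e0; exists 0%N => n _; rewrite subrr normr0 ltcR. Qed.

Lemma cvgCD (u v : nat -> C) (a b : C) :
  cvgC u a -> cvgC v b -> cvgC (fun n => u n + v n) (a + b).
Proof.
move=> ua vb e e0; have d2 : 0 < e / 2 by rewrite divr_gt0.
have [K1 h1] := ua _ d2; have [K2 h2] := vb _ d2.
exists (maxn K1 K2) => n; rewrite geq_max => /andP[/h1 {}h1 /h2 {}h2].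
have -> : u n + v n - (a + b) = (u n - a) + (v n - b) by ring.
apply: le_lt_trans (ler_normD _ _) _.
by rewrite (splitr e) rmorphD /= ltrD.
Qed.

Lemma cvgCMl (c : C) (u : nat -> C) (a : C) :
  cvgC u a -> cvgC (fun n => c * u n) (c * a).
Proof.
move=> ua; apply: cvgCP => e e0.
have p : 0 < normc c + 1 by rewrite -ltcR rmorphD /= -normc_realE ltr_wpDl.
have [K hK] := ua _ (divr_gt0 e0 p).
exists K => n /hK /ltW h; rewrite -mulrBr normrM.
have -> : e%:C = (normc c + 1)%:C * (e / (normc c + 1))%:C.
  by rewrite -rmorphM mulrC divfK // gt_eqF.
by rewrite ler_pM // normc_realE lecR; lra.
Qed.

Lemma cvgC_sum (I : Type) (r : seq I) (u : I -> nat -> C) (a : I -> C) :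
  (forall i, cvgC (u i) (a i)) ->
  cvgC (fun n => \sum_(i <- r) u i n) (\sum_(i <- r) a i).
Proof.
move=> h; elim: r => [|i r IH].
  rewrite big_nil; under eq_fun do rewrite big_nil; exact: cvgC_cst.
rewrite big_cons; under eq_fun do rewrite big_cons.
exact: cvgCD.
Qed.

(** Each [u n] equals its own modulus, so [u] also converges to the modulus of [a], and uniqueness
    of limits identifies the two. *)
Lemma cvgC_ge0 (u : nat -> C) (a : C) :
  cvgC u a -> (forall n, 0 <= u n) -> 0 <= a.
Proof.
move=> ua u0.
suff <- : `|a| = a by [].
apply: (cvgC_unique (u := u)) => //; apply: cvgCP => e e0.
have [K hK] := ua _ e0; exists K => n /hK /ltW; apply: le_trans.
by rewrite -{1}(ger0_norm (u0 n)) ler_dist_dist.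
Qed.

Lemma cvgC_bounded (u : nat -> C) (a : C) :
  cvgC u a -> exists B : R, forall n, `|u n| <= B%:C.
Proof.
move=> /(_ 1 ltr01)[K hK].
have K0 : 0 <= \sum_(i < K) normc (u i).
  by apply: sumr_ge0 => i _; rewrite -ler0c -normc_realE.
have Na : 0 <= normc a by rewrite -ler0c -normc_realE.
exists (\sum_(i < K) normc (u i) + (normc a + 1)) => n.
rewrite normc_realE lecR; case: (ltnP n K) => nK.
  rewrite (bigD1 (Ordinal nK)) //= -!addrA lerDl.
  rewrite addr_ge0 ?addr_ge0 // sumr_ge0 // => i _.
  by rewrite -ler0c -normc_realE.
apply: (@le_trans _ _ (normc a + 1)); last by rewrite lerDr.
rewrite -lecR rmorphD /= -!normc_realE.
rewrite -[u n](subrK a) addrC; apply: le_trans (ler_normD _ _) _.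
by rewrite lerD2l ltW // hK.
Qed.

End Limits.

(** * Polynomials isolating one coefficient *)

Section CoefficientFunctionals.
Variable R : realType.

(** The prefactor makes these values absolutely summable in [k], since [P] is bounded between 0 and
    1. *)
Definition pval (P : {poly R}) (k : nat) : R :=
  k%:R^-1 ^+ 2 * P.[k%:R^-1].

Lemma sum_inv_sqr_le2 (M : nat) :
  \sum_(1 <= k < M.+1) (k%:R^-1 : R) ^+ 2 <= 2.
Proof.
case: M => [|M]; first by rewrite big_geq.
(* The sharper bound is the one that telescopes: [1/(k+1)^2 <= 1/k - 1/(k+1)]. *)
suff : \sum_(1 <= k < M.+2) (k%:R^-1 : R) ^+ 2 <= 2 - M.+1%:R^-1.
  by move/le_trans; apply; rewrite gerBl invr_ge0.
elim: M => [|M IH]; first by rewrite big_nat1 invr1 expr1n; lra.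
rewrite big_nat_recr //=; set x := M.+2%:R^-1.
apply: le_trans (lerD IH (lexx _)) _.
have x0 : 0 < x by rewrite invr_gt0.
have x1 : 0 < 1 - x.
  by rewrite subr_gt0 invf_lt1 ?ltr1n // ltr0n.
have -> : (M.+1%:R : R)^-1 = x / (1 - x).
  have -> : (M.+1%:R : R) = x^-1 - 1 by rewrite invrK -[M.+2%:R]natr1 addrK.
  by field; rewrite !gt_eqF //=; rewrite !lt0r_neq0.
suff : x + x ^+ 2 <= x / (1 - x) by lra.
rewrite ler_pdivlMr //; nra.
Qed.

Lemma geometric_to0 (D q e : R) : 0 <= q < 1 -> 0 < e ->
  exists K, forall l, (K <= l)%N -> D * q ^+ l <= e.
Proof.
move=> /andP[q0 q1] e0.
have q_lt1 : `|q| < 1 by rewrite ger0_norm.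
have [K _ hK] := iffLR (cvgrPdist_lt _ _) (cvg_geometric D q_lt1) _ e0.
exists K => l /hK /=.
by rewrite sub0r normrN => /ltW; apply: le_trans; exact: ler_norm.
Qed.

Let Q (m : nat) : {poly R} := \prod_(1 <= j < m) (1 - j%:R%:P * 'X).

Let hornerQ m x : (Q m).[x] = \prod_(1 <= j < m) (1 - j%:R * x).
Proof.
by rewrite /Q horner_prod; apply: eq_bigr => j _; rewrite !hornerE.
Qed.

(* The zeros of the factor [Q m] annihilate the values at [1/k], [k < m], while
   [(m/k)^l] makes those at [1/k], [k > m], small. *)
Lemma approx_delta (m : nat) : (0 < m)%N ->
  exists P : nat -> {poly R}, forall e : R, 0 < e ->
    exists K, forall l, (K <= l)%N -> forall M,
      \sum_(1 <= k < M.+1) `|pval (P l) k - (k == m)%:R| <= e.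
Proof.
move=> m0; have mR : 0 < m%:R :> R by rewrite ltr0n.
have Qm : 0 < (Q m).[m%:R^-1].
  rewrite hornerQ big_nat_cond; apply: prodr_gt0 => j /andP[/andP[_ jm] _].
  by rewrite subr_gt0 ltr_pdivrMr // mul1r ltr_nat.
(* The constant makes the value at [m] exactly 1: [m^2] cancels the prefactor of [pval], [m^l]
   cancels ['X^l] at [1/m], and the division removes [Q m]. *)
exists (fun l => (m%:R ^+ 2 * m%:R ^+ l / (Q m).[m%:R^-1])%:P * 'X^l * Q m).
move=> e e0; pose D := m%:R ^+ 2 / (Q m).[m%:R^-1].
have D0 : 0 < D by rewrite divr_gt0 // exprn_gt0.
have q01 : 0 <= (m%:R / m.+1%:R : R) < 1.
  by rewrite divr_ge0 //= ltr_pdivrMr // mul1r ltr_nat.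
have [K hK] := geometric_to0 (D * 2) q01 e0.
exists K => l /hK {}hK M; apply: le_trans hK.
set E := (_ / _) ^+ l; have E0 : 0 <= E by rewrite exprn_ge0 //; case/andP: q01.
(* For [k > m], [(m/k)^l <= E] and [Q m] lies between 0 and 1 at [1/k]. The 2 in [D * 2] bounds the
   sum of [k^-2], uniformly in [M]. *)
apply: (@le_trans _ _ (\sum_(1 <= k < M.+1) (D * E) * (k%:R^-1) ^+ 2)); last first.
  rewrite -mulr_sumr [leRHS]mulrAC.
  by apply: ler_wpM2l; [rewrite mulr_ge0 // ltW | exact: sum_inv_sqr_le2].
rewrite big_nat_cond [leRHS]big_nat_cond; apply: ler_sum => k.
rewrite andbT => /andP[k0 _]; rewrite /pval !hornerM hornerC hornerXn.
have kR : 0 < k%:R :> R by rewrite ltr0n.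
have RHS0 : 0 <= D * E * k%:R^-1 ^+ 2.
  by rewrite mulr_ge0 ?exprn_ge0 ?invr_ge0 // mulr_ge0 // ltW.
case: (ltngtP k m) => km.
- have -> : (Q m).[k%:R^-1] = 0.
    rewrite hornerQ (big_cat_nat (n := k)) //=; last exact: ltnW.
    by rewrite [X in _ * X]big_ltn // divff ?gt_eqF // subrr mul0r mulr0.
  by rewrite !mulr0 subrr normr0.
- have Qk : 0 <= (Q m).[k%:R^-1] <= 1.
    rewrite hornerQ big_nat_cond; apply/andP; split.
      apply: prodr_ge0 => j /andP[/andP[_ jm] _].
      rewrite subr_ge0 ler_pdivrMr // mul1r ler_nat ltnW //.
      exact: ltn_trans km.
    apply: prodr_ile1 => j /andP[/andP[_ jm] _].
    rewrite subr_ge0 ler_pdivrMr // mul1r ler_nat ltnW ?(ltn_trans jm km) //=.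
    by rewrite gerBl divr_ge0 // ltW.
  case/andP: Qk => Qk0 Qk1.
  rewrite subr0 ger0_norm; last first.
    by rewrite !mulr_ge0 ?exprn_ge0 ?invr_ge0 // ltW.
  rewrite mulrC; apply: ler_wpM2r; first by rewrite exprn_ge0 ?invr_ge0.
  apply: (@le_trans _ _ (D * (m%:R ^+ l * k%:R^-1 ^+ l) * 1)).
    have -> : m%:R ^+ 2 * m%:R ^+ l / (Q m).[m%:R^-1] * k%:R^-1 ^+ l
              = D * (m%:R ^+ l * k%:R^-1 ^+ l) by rewrite /D; ring.
    apply: ler_wpM2l => //; apply: mulr_ge0; first exact: ltW.
    by rewrite mulr_ge0 ?exprn_ge0 ?invr_ge0 // ltW.
  rewrite mulr1; apply: ler_wpM2l; first exact: ltW.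
  rewrite -exprMn.
  rewrite lerXn2r ?nnegrE ?divr_ge0 //.
  by apply: ler_wpM2l => //; rewrite lef_pV2 ?posrE // ler_nat.
- rewrite km; set q := (Q m).[_].
  have -> : m%:R^-1 ^+ 2 * (m%:R ^+ 2 * m%:R ^+ l / q * m%:R^-1 ^+ l * q) = 1.
    by rewrite !exprVn; field; rewrite !expf_neq0 ?gt_eqF.
  by rewrite subrr normr0 -km.
Qed.

End CoefficientFunctionals.

(** * Testing bounded sequences and matrices against these polynomials *)

Section Testing.
Variable R : realType.
Local Notation C := R[i].

(** Bounding all partial sums expresses an [l^1] distance without forming an infinite sum. *)
Definition delta_within (P : {poly R}) (n : nat) (e : R) : Prop :=
  forall M, \sum_(1 <= k < M.+1) `|pval P k - (k == n)%:R| <= e.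

Lemma sum_nat_delta (b : nat -> C) (m M : nat) : (0 < m <= M)%N ->
  \sum_(1 <= k < M.+1) b k * ((k == m)%:R : R)%:C = b m.
Proof.
move=> mM; rewrite (bigD1_seq m) ?iota_uniq ?mem_index_iota //= eqxx mulr1.
by rewrite big1 ?addr0 // => k /negPf ->; rewrite mulr0.
Qed.

(** The difference pairs [b] with [pval P] minus the indicator of [m]: a supremum bound times an
    [l^1] bound. *)
Lemma test_row (b : nat -> C) (B e : R) (P : {poly R}) (m M : nat) :
  (0 < m <= M)%N -> (forall k, (0 < k)%N -> `|b k| <= B%:C) ->
  delta_within P m e ->
  `|\sum_(1 <= k < M.+1) b k * (pval P k)%:C - b m| <= (B * e)%:C.
Proof.
move=> mM hb hP; rewrite -(sum_nat_delta b mM) -sumrB.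
have B0 : 0 <= B by rewrite -ler0c; apply: le_trans (hb 1%N _).
apply: le_trans (ler_norm_sum _ _ _) _.
apply: (@le_trans _ _
  (\sum_(1 <= k < M.+1) B%:C * `|pval P k - (k == m)%:R|%:C)).
  rewrite big_nat_cond [leRHS]big_nat_cond; apply: ler_sum => k.
  rewrite andbT => /andP[k0 _].
  rewrite -mulrBr normrM -rmorphB /= normr_realC.
  by apply: ler_wpM2r; [rewrite ler0c | exact: hb].
rewrite -mulr_sumr -rmorph_sum -rmorphM /= lecR.
by apply: ler_wpM2l.
Qed.

(** Test twice: the inner sums approximate column [n] within [B * e] and are bounded by [B * e + B],
    so the outer test costs a further [(B * e + B) * e]. *)
Lemma test_matrix (b : nat -> nat -> C) (B e : R) (P Q : {poly R}) (m n M : nat) :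
  (0 < m <= M)%N -> (0 < n <= M)%N ->
  (forall k l, (0 < k)%N -> (0 < l)%N -> `|b k l| <= B%:C) ->
  delta_within P m e -> delta_within Q n e ->
  `|\sum_(1 <= k < M.+1) (\sum_(1 <= l < M.+1) b k l * (pval Q l)%:C)
       * (pval P k)%:C - b m n| <= (B * e * (2 + e))%:C.
Proof.
move=> mM nM hb hP hQ.
pose r k := \sum_(1 <= l < M.+1) b k l * (pval Q l)%:C.
have hr k : (0 < k)%N -> `|r k - b k n| <= (B * e)%:C.
  by move=> k0; apply: test_row => // l; exact: hb.
have rB k : (0 < k)%N -> `|r k| <= (B * e + B)%:C.
  move=> k0; rewrite -[r k](subrK (b k n)); apply: le_trans (ler_normD _ _) _.
  by rewrite rmorphD lerD ?hr ?hb //; case/andP: nM.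
have := test_row mM rB hP.
have m0 : (0 < m)%N by case/andP: mM.
have -> : \sum_(1 <= k < M.+1) r k * (pval P k)%:C - b m n =
  (\sum_(1 <= k < M.+1) r k * (pval P k)%:C - r m) + (r m - b m n) by ring.
move=> h; apply: le_trans (ler_normD _ _) _.
apply: le_trans (lerD h (hr m m0)) _.
rewrite -rmorphD lecR; lra.
Qed.

End Testing.

(** * Bounded partial sums of regularly convergent double series *)

Section Npow.
Variable R : realType.
Local Notation C := R[i].

Lemma npow_neg_conj (n : nat) (s : C) : npow_neg n (conjc s) = (npow_neg n s)^*.
Proof. by case: s => x y; rewrite /npow_neg /= !mulNr cosN sinN mulrN. Qed.

Lemma npow_neg_realD (n : nat) (x : R) (l : nat) : (0 < n)%N ->
  npow_neg n (x + l%:R)%:C = (expR (- x * ln n%:R) * n%:R^-1 ^+ l)%:C.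
Proof.
move=> n0; rewrite /npow_neg /= mul0r cos0 sin0 mulr0 oppr0 mulr1; congr (_ +i* _).
rewrite opprD mulrDl expRD; congr (_ * _).
by rewrite mulNr expRN expRM_natl lnK ?posrE ?ltr0n // exprVn.
Qed.

End Npow.

Section DoubleSeries.
Variable R : realType.
Local Notation C := R[i].
Variable c : nat -> nat -> C.

(** Convergence controls only rectangles with both sides at least [K]. Any other rectangle consists
    of fewer than [K] columns or fewer than [K] rows, each bounded by hypothesis. *)
Lemma psum2_bounded (L : C) : dcvgC c L ->
  (forall n, (0 < n)%N -> exists B : R, forall M, `|psum1 (fun m => c m n) M| <= B%:C) ->
  (forall m, (0 < m)%N -> exists B : R, forall N, `|psum1 (fun n => c m n) N| <= B%:C) ->
  exists B : R, forall M N, `|psum2 c M N| <= B%:C.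
Proof.
move=> /(_ 1 ltr01)[K hK] hcol hrow.
(* [choice] wants a total family, so index 0 receives the dummy bound 0. *)
have /choice[f hf] : forall n, exists B : R, (0 < n)%N ->
    forall M, `|psum1 (fun m => c m n) M| <= B%:C.
  move=> n; case: (posnP n) => [->|/hcol[B hB]]; first by exists 0.
  by exists B.
have /choice[g hg] : forall m, exists B : R, (0 < m)%N ->
    forall N, `|psum1 (fun n => c m n) N| <= B%:C.
  move=> m; case: (posnP m) => [->|/hrow[B hB]]; first by exists 0.
  by exists B.
pose F := \sum_(1 <= n < K.+1) `|f n|; pose G := \sum_(1 <= n < K.+1) `|g n|.
have partial (h : nat -> R) N : (N < K)%N ->
    \sum_(1 <= n < N.+1) `|h n| <= \sum_(1 <= n < K.+1) `|h n|.
  move=> NK; rewrite [leRHS](big_cat_nat (n := N.+1)) //=; last exact: leqW.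
  by rewrite lerDl sumr_ge0.
have F0 : 0 <= F by rewrite sumr_ge0.
have G0 : 0 <= G by rewrite sumr_ge0.
have L0 : 0 <= normc L + 1 by rewrite -ler0c rmorphD /= addr_ge0 // -normc_realE.
exists (F + (G + (normc L + 1))) => M N.
case: (ltnP N K) => NK; last case: (ltnP M K) => MK.
- apply: (@le_trans _ _ F%:C); last by rewrite lecR lerDl addr_ge0.
  rewrite /psum2 exchange_big /=; apply: le_trans (ler_norm_sum _ _ _) _.
  apply: le_trans (_ : (\sum_(1 <= n < N.+1) `|f n|)%:C <= _); last first.
    by rewrite lecR partial.
  rewrite rmorph_sum big_nat_cond [leRHS]big_nat_cond; apply: ler_sum => k.
  rewrite andbT => /andP[k0 _]; apply: le_trans (hf k k0 M) _.
  by rewrite lecR ler_norm.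
- apply: (@le_trans _ _ G%:C).
    rewrite /psum2; apply: le_trans (ler_norm_sum _ _ _) _.
    apply: le_trans (_ : (\sum_(1 <= n < M.+1) `|g n|)%:C <= _); last first.
      by rewrite lecR partial.
    rewrite rmorph_sum big_nat_cond [leRHS]big_nat_cond; apply: ler_sum => k.
    rewrite andbT => /andP[k0 _]; apply: le_trans (hg k k0 N) _.
    by rewrite lecR ler_norm.
  by rewrite lecR; lra.
- apply: (@le_trans _ _ (normc L + 1)%:C); last by rewrite lecR; lra.
  rewrite -[psum2 _ _ _](subrK L); apply: le_trans (ler_normD _ _) _.
  by rewrite addrC rmorphD lerD // ltW // hK.
Qed.

(** A column is the difference of two rectangles, which makes the bound uniform in [n] as well as in
    [M]. *)
Lemma column_bounded (B : R) : (forall M N, `|psum2 c M N| <= B%:C) ->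
  forall M n, (0 < n)%N -> `|psum1 (fun m => c m n) M| <= (B + B)%:C.
Proof.
move=> hB M [//|n] _.
have -> : psum1 (fun m => c m n.+1) M = psum2 c M n.+1 - psum2 c M n.
  rewrite /psum2 -sumrB; apply: eq_bigr => m _.
  by rewrite big_nat_recr //= addrAC subrr add0r.
by apply: le_trans (ler_normB _ _) _; rewrite rmorphD lerD.
Qed.

Lemma entry_bounded (B : R) : (forall M N, `|psum2 c M N| <= B%:C) ->
  forall m n, (0 < m)%N -> (0 < n)%N -> `|c m n| <= (B + B + (B + B))%:C.
Proof.
move=> hB [//|m] n _ n0.
have -> : c m.+1 n = psum1 (fun m => c m n) m.+1 - psum1 (fun m => c m n) m.
  by rewrite /psum1 big_nat_recr //= addrAC subrr add0r.
by apply: le_trans (ler_normB _ _) _; rewrite rmorphD lerD // column_bounded.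
Qed.

End DoubleSeries.

(** * Combinations of kernel values *)

Section KernelTesting.
Variables (R : realType) (rho : R) (a : nat -> nat -> R[i]).
Hypothesis Hker : dirichlet_series_kernel rho a.
Local Notation C := R[i].

(** The power [k^-(rho+1)]: the exponent comes from a real point inside the half plane, where
    regular convergence is available. *)
Definition weight (k : nat) : R := expR (- (rho + 1) * ln k%:R).

(* The [.+2] makes the [k^-2] of [pval] appear, whence summability in [k]. *)
Definition pt (l : nat) : C := (rho + 1 + l.+2%:R)%:C.

Lemma weight_gt0 k : 0 < weight k.
Proof. exact: expR_gt0. Qed.

Lemma weightC_neq0 k : (weight k)%:C != 0.
Proof. by rewrite -(rmorph0 (real_complex R)) (inj_eq (@complexI _)) gt_eqF // weight_gt0. Qed.

Lemma Hplane_pt l : Hplane rho (pt l).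
Proof. by rewrite /Hplane /= -addrA ltrDl ltr_pwDl. Qed.

Lemma npow_neg_weight k : npow_neg k (rho + 1)%:C = (weight k)%:C.
Proof.
by rewrite /npow_neg /= mul0r cos0 sin0 mulr0 oppr0 mulr1.
Qed.

Lemma npow_neg_pt k l : (0 < k)%N ->
  npow_neg k (pt l) = (weight k)%:C * (k%:R^-1 ^+ 2 * k%:R^-1 ^+ l)%:C.
Proof. by move=> k0; rewrite npow_neg_realD // -exprD -rmorphM. Qed.

Lemma Hplane_conj s : Hplane rho s -> Hplane rho (conjc s).
Proof. by case: s. Qed.

(** Square partial sums turn the double limit into a sequential one. Since [kappa] conjugates [u],
    convergence is taken at the conjugate point. *)
Lemma kappa_cvg s u : Hplane rho s -> Hplane rho u ->
  cvgC (fun M => psum2 (fun m n => a m n * npow_neg m s * npow_neg n (conjc u)) M M)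
    (kappa a s u).
Proof.
move=> hs hu; have [h _] := Hker hs (Hplane_conj hu).
have {}h := xgetPex 0 h; move=> e /h[K hK]; exists K => n Kn; exact: hK.
Qed.

Lemma kappa_pt_cvg s q : Hplane rho s ->
  cvgC (fun M => psum2 (fun m n => a m n * npow_neg m s * npow_neg n (pt q)) M M)
    (kappa a s (pt q)).
Proof.
move=> hs; rewrite -{1}[pt q]conjc_real; apply: kappa_cvg => //.
exact: Hplane_pt.
Qed.

Lemma rect_bounded s u : Hplane rho s -> Hplane rho u ->
  exists B : R, forall M N,
    `|psum2 (fun m n => a m n * npow_neg m s * npow_neg n u) M N| <= B%:C.
Proof.
move=> hs hu; have [[L hL] [hcol hrow]] := Hker hs hu.
apply: (psum2_bounded hL) => [n n0|m m0].
- have [l hl] := hcol n n0.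
  have [B hB] := cvgC_bounded (cvgCMl (npow_neg n u) hl).
  exists B => M; apply: le_trans (hB M); rewrite /psum1 mulr_sumr.
  by under [X in _ <= `|X|]eq_bigr do rewrite mulrC.
- have [l hl] := hrow m m0.
  have [B hB] := cvgC_bounded (cvgCMl (npow_neg m s) hl).
  exists B => N; apply: le_trans (hB N); rewrite /psum1 mulr_sumr.
  by under [X in _ <= `|X|]eq_bigr do rewrite mulrCA mulrA.
Qed.

(** The terms of the double series at [(rho + 1, rho + 1)], hence bounded. *)
Definition norm_coef (m n : nat) : C := a m n * (weight m)%:C * (weight n)%:C.

Definition row_sum (s : C) (M n : nat) : C :=
  psum1 (fun m => a m n * npow_neg m s) M * (weight n)%:C.

(** At the point [(s, rho + 1)] column [n] carries the factor [weight n], so the uniform column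
    bound applies. *)
Lemma row_sum_bounded s : Hplane rho s ->
  exists B : R, forall M n, (0 < n)%N -> `|row_sum s M n| <= B%:C.
Proof.
move=> hs; have h1 : Hplane rho (rho + 1)%:C by rewrite /Hplane /= ltrDl.
have [B /column_bounded hB] := rect_bounded hs h1.
exists (B + B) => M n /(hB M); rewrite /row_sum /psum1 mulr_suml.
by rewrite npow_neg_weight.
Qed.

Lemma norm_coef_bounded :
  exists B : R, forall m n, (0 < m)%N -> (0 < n)%N -> `|norm_coef m n| <= B%:C.
Proof.
have h1 : Hplane rho (rho + 1)%:C by rewrite /Hplane /= ltrDl.
have [B /entry_bounded hB] := rect_bounded h1 h1.
by exists (B + B + (B + B)) => m n m0 n0; have := hB m n m0 n0; rewrite !npow_neg_weight.
Qed.

Lemma row_sum_cvg s n : Hplane rho s -> (0 < n)%N ->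
  cvgC (fun M => row_sum s M n) (analytic_symbol a n s * (weight n)%:C).
Proof.
move=> hs n0; have [_ [hcol _]] := Hker hs hs.
have {}hcol := xgetPex 0 (hcol n n0).
rewrite mulrC; under eq_fun do rewrite /row_sum mulrC.
exact: cvgCMl.
Qed.

Definition kcomb (P : {poly R}) (s : C) : C :=
  \sum_(q < size P) (P`_q)%:C * kappa a s (pt q).

(** The Gram value of the kernel combinations attached to [Q] and [P]; conjugation leaves their real
    coefficients unchanged. *)
Definition kgram (P Q : {poly R}) : C :=
  \sum_(p < size P) (P`_p)%:C * kcomb Q (pt p).

Lemma pval_coef (P : {poly R}) k :
  (pval P k)%:C = \sum_(q < size P) (P`_q)%:C * (k%:R^-1 ^+ 2 * k%:R^-1 ^+ q)%:C.
Proof.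
rewrite /pval horner_coef mulr_sumr rmorph_sum; apply: eq_bigr => q _.
by rewrite -rmorphM /= mulrCA.
Qed.

(** The finite sum over the coefficients of [P] moves inside each square partial sum, where the
    powers of [1/k] assemble into [pval P k]. *)
Lemma kcomb_cvg (P : {poly R}) s : Hplane rho s ->
  cvgC (fun M => \sum_(1 <= k < M.+1) row_sum s M k * (pval P k)%:C) (kcomb P s).
Proof.
move=> hs.
have := cvgC_sum (index_enum _) (fun q : 'I_(size P) =>
  cvgCMl (P`_q)%:C (kappa_pt_cvg q hs)).
congr (cvgC _ _); apply: funext => M.
under [RHS]eq_bigr do rewrite pval_coef mulr_sumr.
rewrite [RHS]exchange_big /=; apply: eq_bigr => q _.
rewrite /psum2 exchange_big /= mulr_sumr.
apply: eq_big_nat => k /andP[k0 _].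
rewrite /row_sum /psum1 -mulr_suml npow_neg_pt //; ring.
Qed.

Lemma kgram_cvg (P Q : {poly R}) :
  cvgC (fun M => \sum_(1 <= k < M.+1)
      (\sum_(1 <= l < M.+1) norm_coef k l * (pval Q l)%:C) * (pval P k)%:C)
    (kgram P Q).
Proof.
have := cvgC_sum (index_enum _) (fun p : 'I_(size P) =>
  cvgCMl (P`_p)%:C (kcomb_cvg Q (Hplane_pt p))).
congr (cvgC _ _); apply: funext => M.
under [RHS]eq_bigr do rewrite pval_coef mulr_sumr.
rewrite [RHS]exchange_big /=; apply: eq_bigr => p _.
under [RHS]eq_bigr do rewrite mulr_suml.
rewrite [RHS]exchange_big /= mulr_sumr; apply: eq_bigr => l _.
rewrite /row_sum /psum1 !mulr_suml mulr_sumr.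
apply: eq_big_nat => k /andP[k0 _].
rewrite npow_neg_pt // /norm_coef; ring.
Qed.

(** Both limits run along the same truncation [M], so [test_row] compares finite sums and its bound
    passes to the limit. [B] is independent of [n], [P] and [e]. *)
Lemma kcomb_close s : Hplane rho s -> exists B : R,
  forall n (P : {poly R}) (e : R), (0 < n)%N -> delta_within P n e ->
    `|kcomb P s - analytic_symbol a n s * (weight n)%:C| <= (B * e)%:C.
Proof.
move=> hs; have [B hB] := row_sum_bounded hs; exists B => n P e n0 hP.
apply: (cvgC_close (kcomb_cvg P hs) (row_sum_cvg hs n0)).
exists n => M nM; apply: test_row => //; first by rewrite n0.
by move=> k; exact: hB.
Qed.

Lemma kgram_close : exists B : R,
  forall m n (P Q : {poly R}) (e : R), (0 < m)%N -> (0 < n)%N ->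
    delta_within P m e -> delta_within Q n e ->
    `|kgram P Q - norm_coef m n| <= (B * e * (2 + e))%:C.
Proof.
have [B hB] := norm_coef_bounded; exists B => m n P Q e m0 n0 hP hQ.
apply: (cvgC_close (kgram_cvg P Q) (cvgC_cst _)).
exists (maxn m n) => M; rewrite geq_max => /andP[mM nM].
by apply: test_matrix => //; rewrite ?m0 ?n0.
Qed.

Lemma small_modulus (B e : R) : 0 < e ->
  exists2 d : R, 0 < d & B * d * (2 + d) <= e.
Proof.
move=> e0; have p : 0 < 3 * (`|B| + 1) + e by rewrite addr_gt0 // mulr_gt0 // ltr_wpDl.
(* Adding [e] to the denominator forces [d <= 1], hence [2 + d <= 3]. *)
exists (e / (3 * (`|B| + 1) + e)); first exact: divr_gt0.
set d := _ / _; have d0 : 0 < d by exact: divr_gt0.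
have d1 : d <= 1.
  by rewrite ler_pdivrMr // mul1r lerDr mulr_ge0 // addr_ge0.
have hd : d * (3 * (`|B| + 1) + e) = e by rewrite /d divfK // gt_eqF.
have hB := ler_norm B; have B0 := normr_ge0 B.
apply: (@le_trans _ _ (`|B| * d * 3)); last by nra.
apply: (@le_trans _ _ (`|B| * d * (2 + d))).
  by apply: ler_wpM2r; [lra | apply: ler_wpM2r => //; exact: ltW].
by apply: ler_wpM2l; [rewrite mulr_ge0 // ltW | lra].
Qed.

Lemma kcomb_delta_cvg (n : nat) (P : nat -> {poly R}) s : (0 < n)%N ->
  Hplane rho s ->
  (forall e, 0 < e -> exists K, forall l, (K <= l)%N -> delta_within (P l) n e) ->
  cvgC (fun l => kcomb (P l) s) (analytic_symbol a n s * (weight n)%:C).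
Proof.
move=> n0 hs hP; have [B hB] := kcomb_close hs.
apply: cvgCP => e e0; have [d d0 hd] := small_modulus `|B| e0.
have [K hK] := hP d d0; exists K => l /hK h.
apply: le_trans (hB n _ _ n0 h) _; rewrite lecR.
have := ler_norm B; have := normr_ge0 B; nra.
Qed.

Lemma kgram_delta_cvg (m n : nat) (P Q : nat -> {poly R}) :
  (0 < m)%N -> (0 < n)%N ->
  (forall e, 0 < e -> exists K, forall l, (K <= l)%N -> delta_within (P l) m e) ->
  (forall e, 0 < e -> exists K, forall l, (K <= l)%N -> delta_within (Q l) n e) ->
  forall e : R, 0 < e -> exists K, forall l l', (K <= l)%N -> (K <= l')%N ->
    `|kgram (P l) (Q l') - norm_coef m n| <= e%:C.
Proof.
move=> m0 n0 hP hQ e e0; have [B hB] := kgram_close.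
have [d d0 hd] := small_modulus B e0.
have [K hK] := hP d d0; have [K' hK'] := hQ d d0.
exists (maxn K K') => l l'; rewrite !geq_max => /andP[/hK h _] /andP[_ /hK' h'].
by apply: le_trans (hB m n _ _ _ m0 n0 h h') _; rewrite lecR.
Qed.

End KernelTesting.

(** * Positivity of the kernel and of its coefficients *)

Section Equivalence.
Variables (R : realType) (rho : R) (a : nat -> nat -> R[i]).
Hypothesis Hker : dirichlet_series_kernel rho a.
Local Notation C := R[i].
Local Notation kap := (fun s u : Hrho rho => kappa a (sval s) (sval u)).

(** Change of variables in a sesquilinear form. It serves both implications, with [u] made of
    conjugated powers [m^-s] or of polynomial coefficients. *)
Lemma quadratic_form_pullback (I J : finType) (b : J -> J -> C) (c : I -> C)
    (u : I -> J -> C) :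
  \sum_m \sum_n (\sum_i c i * u i m)^* * b m n * (\sum_j c j * u j n) =
  \sum_i \sum_j (c i)^* * (\sum_m \sum_n (u i m)^* * b m n * u j n) * c j.
Proof.
transitivity (\sum_m \sum_n \sum_i \sum_j
    (c i)^* * ((u i m)^* * b m n * u j n) * c j).
  apply: eq_bigr => m _; apply: eq_bigr => n _.
  rewrite rmorph_sum /= !mulr_suml; apply: eq_bigr => i _.
  rewrite mulr_sumr; apply: eq_bigr => j _.
  by rewrite rmorphM /=; ring.
under eq_bigr => m _ do rewrite exchange_big /=.
rewrite exchange_big /=; apply: eq_bigr => i _.
under eq_bigr => m _ do rewrite exchange_big /=.
rewrite exchange_big /=; apply: eq_bigr => j _.
rewrite mulr_sumr mulr_suml; apply: eq_bigr => m _.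
by rewrite mulr_sumr mulr_suml; apply: eq_bigr => n _.
Qed.

Lemma psd_kernel_of_formally_psd : formally_psd a -> psd_kernel kap.
Proof.
move=> ha N x c.
(* The form conjugates its left vector, so this conjugate restores [m^-s] on the left and gives the
   power at the conjugate point on the right. *)
pose u i (m : nat) : C := (npow_neg m (sval (x i)))^*.
have := cvgC_sum (index_enum _) (fun i : 'I_N =>
  cvgC_sum (index_enum _) (fun j : 'I_N =>
  cvgCMl ((c i)^* * c j) (kappa_cvg Hker (svalP (x i)) (svalP (x j))))).
move/cvgC_ge0; have -> : \sum_i \sum_j (c i)^* * c j * kappa a (sval (x i)) (sval (x j))
   = \sum_(i < N) \sum_(j < N) (c i)^* * (\matrix_(i, j) kap (x i) (x j)) i j * c j.
  by apply: eq_bigr => i _; apply: eq_bigr => j _; rewrite mxE mulrAC.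
apply=> M.
have := ha M (fun i => exist _ i.+1 isT) (fun m => \sum_i c i * u i m.+1).
under eq_bigr do under eq_bigr do rewrite mxE /=.
rewrite (quadratic_form_pullback (fun m n : 'I_M => a m.+1 n.+1) c
  (fun i m => u i m.+1)).
congr (0 <= _); apply: eq_bigr => i _; apply: eq_bigr => j _.
rewrite mulrAC; congr (_ * _).
rewrite /psum2 big_add1 big_mkord; apply: eq_bigr => m _.
rewrite big_add1 big_mkord; apply: eq_bigr => n _.
by rewrite /u [X in X * _ * _]conjcK npow_neg_conj (mulrC (npow_neg _ _)).
Qed.

Lemma sum_coef_widen (P : {poly R}) (D : nat) (g : nat -> C) : (size P <= D)%N ->
  \sum_(p < size P) (P`_p)%:C * g p = \sum_(p < D) (P`_p)%:C * g p.
Proof.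
move=> PD; rewrite (big_ord_widen D (fun p => (P`_p)%:C * g p) PD).
rewrite big_mkcond; apply: eq_bigr => p _; case: ltnP => // Pp.
by rewrite nth_default // mul0r.
Qed.

(** Padding all polynomials with zero coefficients to a common length [D] presents this as the form
    of the kernel at the first [D] points [pt]. *)
Lemma kgram_psd (N : nat) (P : 'I_N -> {poly R}) (c : 'I_N -> C) :
  psd_kernel kap ->
  0 <= \sum_i \sum_j (c i)^* * kgram rho a (P i) (P j) * c j.
Proof.
move=> hk; pose D := \max_i size (P i).
have PD i : (size (P i) <= D)%N by exact: leq_bigmax.
have := hk D (fun p => exist _ (pt rho p) (Hplane_pt rho p))
   (fun p => \sum_i c i * ((P i)`_p)%:C).
under eq_bigr do under eq_bigr do rewrite mxE /=.
rewrite (quadratic_form_pullback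
  (fun p q : 'I_D => kappa a (pt rho p) (pt rho q)) c
  (fun i p => ((P i)`_p)%:C)).
congr (0 <= _); apply: eq_bigr => i _; apply: eq_bigr => j _.
congr (_ * _ * _); rewrite /kgram (sum_coef_widen
  (fun p => kcomb rho a (P j) (pt rho p)) (PD i)).
apply: eq_bigr => p _; rewrite /kcomb (sum_coef_widen
  (fun q => kappa a (pt rho p) (pt rho q)) (PD j)) mulr_sumr.
by apply: eq_bigr => q _; rewrite [Num.conj _]conjc_real; ring.
Qed.

Lemma exists_delta_polys : exists P : nat -> nat -> {poly R},
  forall m, (0 < m)%N -> forall e : R, 0 < e ->
    exists K, forall l, (K <= l)%N -> delta_within (P m l) m e.
Proof.
suff /choice[P hP] : forall m, exists P : nat -> {poly R}, (0 < m)%N ->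
    forall e : R, 0 < e ->
    exists K, forall l, (K <= l)%N -> delta_within (P l) m e by exists P.
move=> m; case: (posnP m) => [->|m0]; first by exists (fun=> 0).
by have [P hP] := approx_delta R m0; exists P.
Qed.

Lemma formally_psd_of_psd_kernel : psd_kernel kap -> formally_psd a.
Proof.
move=> hk N x c; have [P hP] := exists_delta_polys.
have hx i : (0 < sval (x i))%N by case: (x i).
(* Dividing by the real weights undoes the normalization in [norm_coef]. *)
pose c' i : C := c i / (weight rho (sval (x i)))%:C.
have cvg i j : cvgC (fun l => kgram rho a (P (sval (x i)) l) (P (sval (x j)) l))
    (norm_coef rho a (sval (x i)) (sval (x j))).
  apply: cvgCP => e e0.
  have [K hK] := kgram_delta_cvg Hker (hx i) (hx j)
    (hP _ (hx i)) (hP _ (hx j)) e0.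
  by exists K => l Kl; exact: hK.
have := cvgC_sum (index_enum _) (fun i : 'I_N =>
  cvgC_sum (index_enum _) (fun j : 'I_N =>
  cvgCMl ((c' i)^* * c' j) (cvg i j))).
move/cvgC_ge0 => h.
have {}h : 0 <= \sum_i \sum_j (c' i)^* * c' j * norm_coef rho a (sval (x i)) (sval (x j)).
  apply: h => l; have := kgram_psd (fun i => P (sval (x i)) l) c' hk.
  by under eq_bigr do under eq_bigr do rewrite mulrAC.
apply: le_trans h _; rewrite le_eqVlt; apply/orP; left; apply/eqP.
apply: eq_bigr => i _; apply: eq_bigr => j _; rewrite mxE /c' /norm_coef.
rewrite rmorphM fmorphV /= ![Num.conj (weight _ _)%:C]conjc_real.
by field; rewrite !weightC_neq0.
Qed.

End Equivalence.

(** * Reproducing kernel Hilbert spaces *)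

Section RKHS.
Variables (R : realType) (X : Type) (k : X -> X -> R[i]).
Variables (H : set (X -> R[i])) (ip : (X -> R[i]) -> (X -> R[i]) -> R[i]).
Hypothesis rk : is_rkhs k H ip.
Local Notation C := R[i].

Lemma rkhs_sub f g : H f -> H g -> H (fun x => f x - g x).
Proof.
move=> hf hg; have := rkhs_add rk hf (rkhs_scale rk (-1) hg).
by under eq_fun do rewrite mulN1r.
Qed.

Lemma ip0l h : H h -> ip (fun=> 0) h = 0.
Proof.
move=> hh; have h0 := rkhs_zero rk.
have := rkhs_ip_linear rk (-1) h0 h0 hh.
by under eq_fun do rewrite mulr0 addr0; rewrite mulN1r addNr.
Qed.

Lemma ipZl c f h : H f -> H h -> ip (fun x => c * f x) h = c * ip f h.
Proof.
move=> hf hh; have := rkhs_ip_linear rk c hf (rkhs_zero rk) hh.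
by under eq_fun do rewrite addr0; rewrite ip0l // addr0.
Qed.

Lemma ipBl f g h : H f -> H g -> H h ->
  ip (fun x => f x - g x) h = ip f h - ip g h.
Proof.
move=> hf hg hh; have := rkhs_ip_linear rk (-1) hg hf hh.
rewrite mulN1r addrC => <-; congr (ip _ h); apply: funext => x.
by rewrite mulN1r addrC.
Qed.

Lemma ipZr c f h : H f -> H h -> ip f (fun x => c * h x) = c^* * ip f h.
Proof.
move=> hf hh; rewrite (rkhs_ip_herm rk (rkhs_scale rk c hh) hf) ipZl //.
by rewrite [_^*]rmorphM /= (rkhs_ip_herm rk hh hf).
Qed.

Lemma ipBr f g h : H f -> H g -> H h ->
  ip h (fun x => f x - g x) = ip h f - ip h g.
Proof.
move=> hf hg hh; rewrite (rkhs_ip_herm rk (rkhs_sub hf hg) hh) ipBl //.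
by rewrite [_^*]rmorphB /= (rkhs_ip_herm rk hf hh) (rkhs_ip_herm rk hg hh).
Qed.

Lemma rkhs_comb (n : nat) (c : nat -> C) (t : nat -> X) :
  H (fun s => \sum_(q < n) c q * k s (t q)).
Proof.
elim: n => [|n IH]; first by under eq_fun do rewrite big_ord0; exact: rkhs_zero rk.
under eq_fun do rewrite big_ord_recr.
exact: (rkhs_add rk IH (rkhs_scale rk _ (rkhs_kernel_mem rk _))).
Qed.

Lemma ip_comb_l (n : nat) (c : nat -> C) (t : nat -> X) h : H h ->
  ip (fun s => \sum_(q < n) c q * k s (t q)) h
  = \sum_(q < n) c q * (h (t q))^*.
Proof.
move=> hh; elim: n => [|n IH].
  by under eq_fun do rewrite big_ord0; rewrite big_ord0 ip0l.
under eq_fun do rewrite big_ord_recr /= addrC.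
have hk := rkhs_kernel_mem rk (t n).
rewrite (rkhs_ip_linear rk _ hk (rkhs_comb n c t) hh) IH big_ord_recr addrC /=.
by rewrite (rkhs_ip_herm rk hh hk) (rkhs_reproducing rk _ hh).
Qed.

Lemma ip_comb_r (n : nat) (c : nat -> C) (t : nat -> X) h : H h ->
  ip h (fun s => \sum_(q < n) c q * k s (t q))
  = \sum_(q < n) (c q)^* * h (t q).
Proof.
move=> hh; rewrite (rkhs_ip_herm rk (rkhs_comb n c t) hh) ip_comb_l //.
by rewrite [_^*]rmorph_sum; apply: eq_bigr => q _; rewrite rmorphM /= conjcK.
Qed.

Lemma ip_cauchy_schwarz f g : H f -> H g ->
  `|ip f g| ^+ 2 <= ip f f * ip g g.
Proof.
move=> hf hg; have [g0|gn0] := eqVneq (ip g g) 0.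
  have -> : ip f g = 0.
    by rewrite (rkhs_ip_herm rk hg hf) (rkhs_ip_def rk hg g0) ip0l // [_^*]rmorph0.
  by rewrite g0 mulr0 normr0 expr0n.
have gp : 0 < ip g g by rewrite lt0r gn0 (rkhs_ip_pos rk hg).
(* The coefficient of the projection of [f] onto [g]; expanding the squared norm of [f - c g] gives
   the inequality. *)
pose c := ip f g / ip g g.
have hcg := rkhs_scale rk c hg.
have := rkhs_ip_pos rk (rkhs_sub hf hcg).
rewrite (ipBl hf hcg (rkhs_sub hf hcg)) !ipBr // !ipZl // !ipZr //.
have -> : ip f f - conjc c * ip f g - (c * ip g f - c * (conjc c * ip g g))
          = ip f f - `|ip f g| ^+ 2 / ip g g.
  rewrite (rkhs_ip_herm rk hf hg).
  have cE : conjc c = conjc (ip f g) / ip g g.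
    rewrite rmorphM fmorphV; congr (_ / _).
    by apply/CrealP; rewrite ger0_real // ltW.
  by rewrite cE normCK /c; field.
by rewrite subr_ge0 ler_pdivrMr.
Qed.

Lemma ip_cvg_l (u : nat -> X -> C) f g : (forall n, H (u n)) -> H f -> H g ->
  cvgC (fun n => ip (fun x => u n x - f x) (fun x => u n x - f x)) 0 ->
  cvgC (fun n => ip (u n) g) (ip f g).
Proof.
move=> hu hf hg cv; apply: cvgCP => e e0.
have gg := rkhs_ip_pos rk hg; have gE : ip g g = (normc (ip g g))%:C.
  by rewrite -normc_realE ger0_norm.
set r := normc _ in gE; have r0 : 0 <= r by rewrite -ler0c -gE.
have r1 : 0 < r + 1 by lra.
(* With [r] the squared norm of [g], Cauchy-Schwarz makes [e^2/(r+1)] a sufficient threshold; the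
   added 1 covers [r = 0]. *)
have [K hK] := cv _ (divr_gt0 (exprn_gt0 2 e0) r1).
exists K => n /hK; rewrite subr0 => /ltW hn.
rewrite -ipBl //; have hs := rkhs_sub (hu n) hf.
rewrite -(@ler_pXn2r _ 2) ?nnegrE ?normr_ge0 //; last by rewrite ler0c ltW.
apply: le_trans (ip_cauchy_schwarz hs hg) _.
rewrite (ger0_norm (rkhs_ip_pos rk hs)) in hn.
rewrite gE; apply: le_trans (_ : (e ^+ 2 / (r + 1))%:C * r%:C <= _).
  by apply: ler_wpM2r; rewrite // ler0c.
rewrite -rmorphM -rmorphXn lecR mulrAC ler_pdivrMr //.
by apply: ler_wpM2l; [exact: sqr_ge0 | lra].
Qed.

End RKHS.

(** * Analytic symbols *)

Section Symbols.
Variables (R : realType) (rho : R) (a : nat -> nat -> R[i]).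
Hypothesis Hker : dirichlet_series_kernel rho a.
Local Notation C := R[i].
Local Notation kap := (fun s u : Hrho rho => kappa a (sval s) (sval u)).
Variables (H : set (Hrho rho -> C)) (ip : (Hrho rho -> C) -> (Hrho rho -> C) -> C).
Hypothesis rk : is_rkhs kap H ip.

Let hpt (l : nat) : Hrho rho := exist _ (pt rho l) (Hplane_pt rho l).
Let kfun (P : {poly R}) : Hrho rho -> C := fun s => kcomb rho a P (sval s).
Let symbol (n : nat) : Hrho rho -> C :=
  fun s => (weight rho n)%:C * analytic_symbol a n (sval s).

Let kfun_mem P : H (kfun P).
Proof. exact: (rkhs_comb rk _ (fun q => (P`_q)%:C) hpt). Qed.

Let ip_kfun_l P f : H f ->
  ip f (kfun P) = \sum_(p < size P) (P`_p)%:C * f (hpt p).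
Proof.
move=> hf; rewrite (ip_comb_r rk _ (fun q => (P`_q)%:C) hpt hf).
by apply: eq_bigr => p _; rewrite [Num.conj _]conjc_real.
Qed.

Let ip_kfun P Q : ip (kfun Q) (kfun P) = kgram rho a P Q.
Proof. by rewrite ip_kfun_l. Qed.

(** The combinations are Cauchy because their Gram values share one limit. Completeness supplies a
    limit in norm, and pairing with kernel functions identifies it pointwise. *)
Lemma symbol_limit (n : nat) (P : nat -> {poly R}) : (0 < n)%N ->
  (forall e, 0 < e -> exists K, forall l, (K <= l)%N -> delta_within (P l) n e) ->
  H (symbol n) /\
  forall g, H g -> cvgC (fun l => ip (kfun (P l)) g) (ip (symbol n) g).
Proof.
move=> n0 hP.
have [|f hf cf] := rkhs_complete rk (u := fun l => kfun (P l)) (fun l => kfun_mem (P l)).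
  move=> e e0; have e8 : 0 < e / 8 by rewrite divr_gt0.
  have [K hK] := kgram_delta_cvg Hker n0 n0 hP hP e8.
  exists K => i j Ki Kj.
  have hd := rkhs_sub rk (kfun_mem (P i)) (kfun_mem (P j)).
  rewrite (ipBl rk) // !(ipBr rk) // !ip_kfun.
  set L := norm_coef rho a n n in hK.
  (* Each of the four deviations from [L] is at most [e / 8], for a total of [e / 2]. *)
  have -> : kgram rho a (P i) (P i) - kgram rho a (P j) (P i)
      - (kgram rho a (P i) (P j) - kgram rho a (P j) (P j))
    = (kgram rho a (P i) (P i) - L) - (kgram rho a (P j) (P i) - L)
      - ((kgram rho a (P i) (P j) - L) - (kgram rho a (P j) (P j) - L)) by ring.
  apply: (@le_lt_trans _ _ ((e / 8 + e / 8) + (e / 8 + e / 8))%:C).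
    rewrite !rmorphD /=.
    by do 2 (apply: le_trans (ler_normB _ _) _; apply: lerD); exact: hK.
  by rewrite ltcR; lra.
suff <- : f = symbol n.
  by split=> // g hg; exact: (ip_cvg_l rk).
apply: funext => s.
have h := ip_cvg_l rk (fun l => kfun_mem (P l)) hf
  (rkhs_kernel_mem rk s) cf.
rewrite -(rkhs_reproducing rk s hf); apply: (cvgC_unique h).
rewrite /symbol mulrC.
under eq_fun do rewrite (rkhs_reproducing rk s (kfun_mem _)).
exact: (kcomb_delta_cvg Hker n0 (svalP s) hP).
Qed.

Lemma symbol_mem n : (0 < n)%N -> H (symbol n).
Proof.
move=> n0; have [P hP] := exists_delta_polys R.
by have [] := symbol_limit n0 (hP n n0).
Qed.

(** Two successive limits of Gram values: first along the polynomials for [n] with the combination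
    for [m] fixed, then along those for [m]. *)
Lemma ip_symbol m n : (0 < m)%N -> (0 < n)%N ->
  ip (symbol n) (symbol m) = norm_coef rho a m n.
Proof.
move=> m0 n0; have [P hP] := exists_delta_polys R.
have [Hn cn] := symbol_limit n0 (hP n n0).
have [Hm cm] := symbol_limit m0 (hP m m0).
have hJ : cvgC (fun l => ip (symbol n) (kfun (P m l))) (norm_coef rho a m n).
  apply: cvgCP => e e0.
  have [K hK] := kgram_delta_cvg Hker m0 n0 (hP m m0) (hP n n0) e0.
  exists K => l Kl.
  apply: (cvgC_close (cn _ (kfun_mem (P m l))) (cvgC_cst _)).
  by exists K => l' Kl'; rewrite ip_kfun; exact: hK.
(* [symbol_limit] takes limits in the first argument; Hermitian symmetry carries this one over to
   the second. *)
have e1 : norm_coef rho a m n = conjc (ip (symbol m) (symbol n)).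
  apply: (cvgC_unique hJ); move: (cm _ Hn).
  move=> h e /h[K hK]; exists K => l /hK.
  rewrite (rkhs_ip_herm rk Hn (kfun_mem _)) -{1}[ip (symbol m) _]conjcK.
  by rewrite -rmorphB normcJ.
by rewrite e1; exact: (rkhs_ip_herm rk Hm Hn).
Qed.

Lemma analytic_symbol_mem n : (0 < n)%N ->
  H (fun s : Hrho rho => analytic_symbol a n (sval s)).
Proof.
move=> n0; have := rkhs_scale rk ((weight rho n)%:C)^-1 (symbol_mem n0).
by rewrite /symbol; under eq_fun do rewrite mulKf ?weightC_neq0 //.
Qed.

Lemma ip_analytic_symbol m n : (0 < m)%N -> (0 < n)%N ->
  a m n = ip (fun s : Hrho rho => analytic_symbol a n (sval s))
             (fun s : Hrho rho => analytic_symbol a m (sval s)).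
Proof.
move=> m0 n0; have hm := analytic_symbol_mem m0; have hn := analytic_symbol_mem n0.
have := ip_symbol m0 n0.
rewrite /symbol (ipZl rk) // ?(ipZr rk) //; last first.
  exact: (rkhs_scale rk).
rewrite [Num.conj _]conjc_real /norm_coef => h.
apply: (mulfI (weightC_neq0 rho m)); apply: (mulfI (weightC_neq0 rho n)).
by rewrite h; ring.
Qed.

End Symbols.

Theorem theorem2p3 (R : realType) (rho : R) (a : nat -> nat -> R[i])
    (Hker : dirichlet_series_kernel rho a) :
  (psd_kernel (fun s u : Hrho rho => kappa a (sval s) (sval u)) <-> formally_psd a) /\
  (psd_kernel (fun s u : Hrho rho => kappa a (sval s) (sval u)) ->
   forall (H : set (Hrho rho -> R[i])) (ip : (Hrho rho -> R[i]) -> (Hrho rho -> R[i]) -> R[i]),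
     is_rkhs (fun s u : Hrho rho => kappa a (sval s) (sval u)) H ip ->
     (forall n, (0 < n)%N -> H (fun s : Hrho rho => analytic_symbol a n (sval s))) /\
     (forall m n, (0 < m)%N -> (0 < n)%N ->
        a m n = ip (fun s : Hrho rho => analytic_symbol a n (sval s))
                   (fun s : Hrho rho => analytic_symbol a m (sval s)))).
Proof.
split; first split.
- exact: formally_psd_of_psd_kernel.
- exact: psd_kernel_of_formally_psd.
- move=> _ H ip rk; split=> [n|m n].
  + exact: (analytic_symbol_mem Hker rk).
  + exact: (ip_analytic_symbol Hker rk).
Qed.
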